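(* Let $P$ and $Q$ be two (complex) polynomials of degree $n$ such that $x_P$, $x_Q$ are roots respectively of $P$, $Q$ of multiplicity $m_P$, $m_Q$, with $\mu^*:=m_P+m_Q-n\ge 0$. Then $-x_Px_Q$ is a root of $P\ast Q$ of multiplicity $\mu^*$. (If $\mu^*=0$, then $-x_Px_Q$ is not a root of $P\ast Q$.)
   Context: The Schur–Szegő composition (with respect to $n$) of $P(x)=\sum_{i=0}^n\binom{n}{i}a_ix^i$ and $Q(x)=\sum_{i=0}^n\binom{n}{i}b_ix^i$ is $P\ast Q(x)=\sum_{i=0}^n\binom{n}{i}a_ib_ix^i$.
   Formalization: Added: if x_P = 0 then m_Q = n, and if x_Q = 0 then m_P = n (automatic for nonzero roots); otherwise the claim fails, e.g. n = 2, P = x(x-1), Q = x(x-2), x_P = x_Q = 0, where μ* = 0 but 0 is a root of P∗Q. *)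

(* Defs.v *)
From HB Require Import structures.
From mathcomp Require Import all_boot all_order all_algebra.
From mathcomp Require Import reals complex.

Set Implicit Arguments.
Unset Strict Implicit.
Unset Printing Implicit Defensive.

Import GRing.Theory Num.Theory.

Local Open Scope ring_scope.

(* The a_i of the normalization P = \sum_(i <= n) 'C(n, i) a_i 'X^i. This is
   meaningful for i <= n and over a field where the binomial coefficients
   'C(n, i) are invertible, e.g., in characteristic 0. *)
Definition binom_coef (F : fieldType) (n : nat) (P : {poly F}) (i : nat) : F :=
  P`_i / 'C(n, i)%:R.

Definition schur_szego (F : fieldType) (n : nat) (P Q : {poly F}) : {poly F} :=
  \poly_(i < n.+1) ('C(n, i)%:R * binom_coef n P i * binom_coef n Q i).

Lemma schur_szegoE (F : numFieldType) (n : nat) (a b : nat -> F) :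
  schur_szego n (\sum_(i < n.+1) ('C(n, i)%:R * a i) *: 'X^i)
                (\sum_(i < n.+1) ('C(n, i)%:R * b i) *: 'X^i) =
  \sum_(i < n.+1) ('C(n, i)%:R * a i * b i) *: 'X^i.
Proof.
rewrite -(poly_def n.+1 (fun i => 'C(n, i)%:R * a i)).
rewrite -(poly_def n.+1 (fun i => 'C(n, i)%:R * b i)).
rewrite /schur_szego poly_def; apply: eq_bigr => i _.
have bin_neq0 : 'C(n, i)%:R != 0 :> F by rewrite pnatr_eq0 -lt0n bin_gt0 -ltnS.
by rewrite /binom_coef !coef_poly ltn_ord ![_ * _ / _]mulrAC !divff // !mul1r.
Qed.

(* Main.v *)
(* The composition satisfies (P * Q)' = P' * Q' / n, where the right-hand side
   is composed with respect to n - 1. Differentiation lowers n, m_P, m_Q and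
   hence mu^* by one, so in characteristic 0 it suffices to show that -xy is a
   root when mu^* > 0 and is not one when mu^* = 0. Both are read off the
   formula
     (A (X - x)^p * B (X - y)^q)(-xy)
       = (-x)^p (-y)^q A(x) B(y) / C(p + q, p),
   where n = p + q, deg A <= q and deg B <= p. It is proved by induction on p:
   for evaluation at -xy, the operator adjoint to multiplication of P by X - x
   is, up to a scalar, Q |-> (X - y) Q' - n Q, which maps B (X - y)^q to a
   polynomial of the same shape whose bound on deg B is lowered by one. *)
Require Import Defs.
From mathcomp Require Import all_boot all_order all_algebra.
From mathcomp Require Import reals complex.
From mathcomp Require Import zify ring.

Set Implicit Arguments.
Unset Strict Implicit.
Unset Printing Implicit Defensive.

Import GRing.Theory Num.Theory.
Local Open Scope ring_scope.

Lemma binr_neq0 (F : numFieldType) n i : (i <= n)%N -> 'C(n, i)%:R != 0 :> F.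
Proof. by rewrite pnatr_eq0 -lt0n bin_gt0. Qed.

Lemma binSS_natr (F : numFieldType) n i :
  'C(n.+1, i.+1)%:R = n.+1%:R * 'C(n, i)%:R / i.+1%:R :> F.
Proof.
by rewrite -natrM (mul_bin_diag n.+1 i) natrM mulrAC divff ?mul1r ?pnatr_eq0.
Qed.

Lemma coef_schur_szego (F : numFieldType) n (P Q : {poly F}) i :
  (schur_szego n P Q)`_i =
    if (i <= n)%N then P`_i * Q`_i / 'C(n, i)%:R else 0.
Proof.
rewrite coef_poly ltnS; case: ifP => // /(@binr_neq0 F n i) bin_neq0.
by rewrite /binom_coef; field.
Qed.

Lemma horner_schur_szego (F : numFieldType) n (P Q : {poly F}) z :
  (schur_szego n P Q).[z] =
    \sum_(i < n.+1) P`_i * Q`_i / 'C(n, i)%:R * z ^+ i.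
Proof.
rewrite (@horner_coef_wide _ n.+1) ?size_poly//; apply: eq_bigr => i _.
by rewrite coef_schur_szego -ltnS ltn_ord.
Qed.

Lemma deriv_schur_szego (F : numFieldType) n (P Q : {poly F}) :
  (schur_szego n.+1 P Q)^`() = n.+1%:R^-1 *: schur_szego n P^`() Q^`().
Proof.
apply/polyP => i; rewrite coefZ coef_deriv !coef_schur_szego !coef_deriv ltnS.
case: ifP => [le_in | _]; last by rewrite mul0rn mulr0.
have b_neq0 := @binr_neq0 F n i le_in.
rewrite binSS_natr.
rewrite -![_`__ *+ _]mulr_natl.
by field; rewrite !nat1r b_neq0 !pnatr_eq0.
Qed.

Lemma horner_schur_szego_XsubCM (F : numFieldType) n (P Q : {poly F}) x y :
  (size P <= n.+1)%N ->
  (schur_szego n.+1 (P * ('X - x%:P)) Q).[- (x * y)] =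
  x / n.+1%:R *
    (schur_szego n P (Q^`() * ('X - y%:P) - Q *+ n.+1)).[- (x * y)].
Proof.
move=> szP; set z := - (x * y); rewrite !horner_schur_szego.
have -> : \sum_(i < n.+2) (P * ('X - x%:P))`_i * Q`_i / 'C(n.+1, i)%:R * z ^+ i
  = \sum_(i < n.+1) (P`_i * Q`_i.+1 / 'C(n.+1, i.+1)%:R * z ^+ i.+1)
    - \sum_(i < n.+1) (x * P`_i * Q`_i / 'C(n.+1, i)%:R * z ^+ i).
  rewrite (eq_bigr (fun i : 'I_n.+2 =>
      (P * 'X)`_i * Q`_i / 'C(n.+1, i)%:R * z ^+ i -
      (x * P`_i * Q`_i / 'C(n.+1, i)%:R * z ^+ i))) => [|i _]; last first.
    by rewrite mulrBr coefB coefMC; ring.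
  rewrite sumrB big_ord_recl coefMX /= !mul0r add0r; congr (_ - _).
    by apply: eq_bigr => i _; rewrite coefMX.
  by rewrite big_ord_recr /= (nth_default 0 szP) mulr0 !mul0r addr0.
rewrite mulr_sumr -sumrB; apply: eq_bigr => i _.
have le_in : (i <= n)%N by rewrite -ltnS.
have b_neq0 := @binr_neq0 F n i le_in.
have k_neq0 : (n.+1%:R - i%:R) != 0 :> F.
  by rewrite -natrB ?(leqW le_in) // pnatr_eq0 subn_eq0 -ltnNge.
rewrite binSS_natr.
have -> : 'C(n.+1, i)%:R = n.+1%:R * 'C(n, i)%:R / (n.+1%:R - i%:R) :> F.
  by rewrite -natrM (mul_bin_down n.+1 i) natrM natrB ?leqW // mulrC mulKf.
rewrite [Q^`() * _]mulrBr !coefB coefMn coefMX coefMC [Q^`()`_i]coef_deriv.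
rewrite -![_`__ *+ _]mulr_natl exprS.
(* The factor i absorbs the special case of index 0 in the coefficients of Q' X. *)
have -> : (if i == 0%N :> nat then 0 else Q^`()`_i.-1) = i%:R * Q`_i.
  by case: (nat_of_ord i) => [|j] /=; rewrite ?mul0r // coef_deriv mulr_natl.
by rewrite /z; field; rewrite !nat1r b_neq0 k_neq0 !pnatr_eq0.
Qed.

Lemma horner_schur_szego_factors (F : numFieldType) p q (A B : {poly F}) x y :
  (size A <= q.+1)%N -> (size B <= p.+1)%N ->
  (schur_szego (p + q) (A * ('X - x%:P) ^+ p) (B * ('X - y%:P) ^+ q))
    .[- (x * y)] = (- x) ^+ p * (- y) ^+ q * A.[x] * B.[y] / 'C(p + q, p)%:R.
Proof.
elim: p B => [|p IHp] B szA szB.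
  (* Here B is constant. The binomial in the i-th coefficient of (X - y)^q cancels the denominator,
     and z^i = x^i (-y)^i completes (-y)^(q-i) to (-y)^q, which leaves the sum for A(x). *)
  rewrite [B]size1_polyC // add0n expr0 mulr1 mul1r bin0 divr1 hornerC.
  rewrite horner_schur_szego (horner_coef_wide x szA) mulr_sumr mulr_suml.
  apply: eq_bigr => i _; have le_iq : (i <= q)%N by rewrite -ltnS.
  have -> : (B`_0)%:P * ('X - y%:P) ^+ q = B`_0 *: ('X + (- y)%:P) ^+ q.
    by rewrite mul_polyC polyCN.
  rewrite coefZ addrC exprDn coef_sum (bigD1 i) //= big1 => [|j neq_ji].
    rewrite -polyC_exp coefMn coefCM coefXn eqxx addr0 mulr1.
    rewrite -[_ *+ 'C(_, _)]mulr_natr.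
    have -> : - (x * y) = x * - y by rewrite mulrN.
    have -> : (- y) ^+ q = (- y) ^+ (q - i) * (- y) ^+ i.
      by rewrite -exprD subnK.
    by rewrite exprMn; field; apply: binr_neq0.
  rewrite -polyC_exp coefMn coefCM coefXn eq_sym.
  by rewrite -val_eqE /= in neq_ji; rewrite (negPf neq_ji) mulr0 mul0rn.
(* [B'] is what remains of the adjoint operator once (X - y)^q is factored out: differentiating that
   power yields q B, which reduces the scalar p + q + 1 to p + 1. *)
pose B' := B^`() * ('X - y%:P) - B *+ p.+1.
(* In degree p + 1 both terms contribute (p + 1) B_(p+1), so they cancel. *)
have szB' : (size B' <= p.+1)%N.
  apply/leq_sizeP => j; rewrite leq_eqVlt => /predU1P[<-|lt_pj].
    rewrite coefB coefMn mulrBr coefB coefMX coefMC !coef_deriv /=.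
    by rewrite [B`_p.+2]nth_default // mul0rn mul0r subr0 subrr.
  rewrite coefB coefMn mulrBr coefB coefMX coefMC !coef_deriv.
  case: j lt_pj => // j lt_pj /=.
  rewrite !(@nth_default _ _ B) ?(leq_trans szB) ?mul0rn ?mul0r ?subrr //.
  by rewrite leqW.
have szP : (size (A * ('X - x%:P) ^+ p)%R <= (p + q).+1)%N.
  apply: leq_trans (size_polyMleq _ _) _.
  by rewrite size_exp_XsubC addnS /= addnC -addnS leq_add2l.
rewrite addSn exprSr mulrA horner_schur_szego_XsubCM //.
have -> : (B * ('X - y%:P) ^+ q)^`() * ('X - y%:P)
      - B * ('X - y%:P) ^+ q *+ (p + q).+1 = B' * ('X - y%:P) ^+ q.
  rewrite derivM deriv_exp derivXsubC /B'.
  case: q {IHp szA szP} => [|q]; rewrite ?exprS /=; ring.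
rewrite IHp //.
(* Together with x/(p+q+1), the factor -(p+1) supplies the new -x and turns C(p+q, p) into C(p+q+1,
   p+1). *)
have -> : B'.[y] = - (p.+1%:R * B.[y]).
  by rewrite !hornerE hornerMn -mulr_natl; ring.
rewrite binSS_natr [in RHS]exprS.
by field; rewrite -natrD !nat1r !pnatr_eq0 /= -lt0n bin_gt0 leq_addr.
Qed.

Lemma mup_factor (F : fieldType) (p : {poly F}) x :
  p != 0 -> exists2 q, ~~ root q x & p = q * ('X - x%:P) ^+ mup x p.
Proof.
move=> p_neq0; have [m [q]] := multiplicity_XsubC p x.
rewrite p_neq0 /= => qx defp; exists q => //.
by rewrite {2}defp mupMr // mup_XsubCX eqxx.
Qed.

(** If p = q (X - x)^(m+1), the cofactor of (X - x)^m in p' takes the value (m+1) q(x) at x, which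
    is nonzero in characteristic 0. *)
Lemma mup_deriv (F : numFieldType) (p : {poly F}) x :
  p != 0 -> root p x -> mup x p = (mup x p^`()).+1.
Proof.
move=> p_neq0 px; have [q qx] := mup_factor x p_neq0.
have: (0 < mup x p)%N by rewrite -XsubC_dvd // dvdp_XsubCl.
case: (mup x p) => // m _ ->.
have -> : (q * ('X - x%:P) ^+ m.+1)^`() =
    (q^`() * ('X - x%:P) + q *+ m.+1) * ('X - x%:P) ^+ m.
  by rewrite derivM deriv_exp derivXsubC exprS /=; ring.
rewrite mupMr ?mup_XsubCX ?eqxx //.
rewrite /root !hornerE hornerMn subrr mulr0 add0r.
by rewrite mulrn_eq0 /= -/(root q x).
Qed.

Lemma size_deriv_num (F : numFieldType) (p : {poly F}) :
  size p^`() = (size p).-1.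
Proof.
have [sz|sz] := leqP (size p) 1.
  by rewrite [p]size1_polyC // derivC size_poly0 size_polyC; case: eqP.
have sz_gt0 := ltnW sz; apply/eqP; rewrite eqn_leq size_poly /=.
rewrite -ltnS prednK //; case E: (size p) sz => [|[|k]] // _.
rewrite ltnS ltnNge; apply/negP => /leq_sizeP/(_ k (leqnn k)).
rewrite coef_deriv => /eqP; rewrite mulrn_eq0 /= => /eqP pk.
have: lead_coef p = 0 by rewrite lead_coefE E.
by move/eqP; rewrite lead_coef_eq0 -size_poly_eq0 E.
Qed.

Lemma size_mul_exp_XsubC (F : fieldType) (p : {poly F}) x n :
  p != 0 -> size (p * ('X - x%:P) ^+ n) = (size p + n)%N.
Proof.
move=> p_neq0; rewrite size_Mmonic ?monic_exp ?monicXsubC //.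
by rewrite size_exp_XsubC addnS.
Qed.

Lemma ltn_mup_size (F : fieldType) (p : {poly F}) x :
  p != 0 -> (mup x p < size p)%N.
Proof.
move=> p_neq0; have [q qx defp] := mup_factor x p_neq0.
have q_neq0 : q != 0 by apply: contraNneq qx => ->; rewrite root0.
by rewrite {2}defp size_mul_exp_XsubC // -[ltnLHS]add0n ltn_add2r size_poly_gt0.
Qed.

(** Since C(n, n) = 1, the coefficient of degree n is the product of the two leading
    coefficients. *)
Lemma schur_szego_neq0 (F : numFieldType) n (P Q : {poly F}) :
  size P = n.+1 -> size Q = n.+1 -> schur_szego n P Q != 0.
Proof.
move=> szP szQ; apply/eqP => /(congr1 (coefp n)) /eqP.
rewrite /= coef_schur_szego leqnn binn divr1 coef0 mulf_eq0.
have -> : P`_n = lead_coef P by rewrite lead_coefE szP.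
have -> : Q`_n = lead_coef Q by rewrite lead_coefE szQ.
by rewrite !lead_coef_eq0 -!size_poly_eq0 szP szQ.
Qed.

(* In the notation of the theorem, p = n - m_Q, q = n - m_P and m = mu^*. *)
Lemma mup_schur_szego (F : numFieldType) (m p q : nat) (P Q : {poly F}) x y :
  size P = (p + (q + m)).+1 -> size Q = (p + (q + m)).+1 ->
  mup x P = (p + m)%N -> mup y Q = (q + m)%N ->
  (x = 0 -> p = 0%N) -> (y = 0 -> q = 0%N) ->
  mup (- (x * y)) (schur_szego (p + (q + m)) P Q) = m.
Proof.
move=> + + + + x0 y0; elim: m P Q => [|m IHm] P Q szP szQ multP multQ.
  have P_neq0 : P != 0 by rewrite -size_poly_eq0 szP.
  have Q_neq0 : Q != 0 by rewrite -size_poly_eq0 szQ.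
  have [A Ax defP] := mup_factor x P_neq0.
  have [B By defQ] := mup_factor y Q_neq0.
  have A_neq0 : A != 0 by apply: contraNneq Ax => ->; rewrite root0.
  have B_neq0 : B != 0 by apply: contraNneq By => ->; rewrite root0.
  rewrite multP addn0 in defP; rewrite multQ addn0 in defQ.
  rewrite addn0 defP (size_mul_exp_XsubC x p A_neq0) in szP.
  rewrite addn0 defQ (size_mul_exp_XsubC y q B_neq0) in szQ.
  rewrite addn0; apply: mupNroot.
  rewrite /root defP defQ horner_schur_szego_factors; last 2 first.
  - by rewrite -(leq_add2r p) szP addSn addnC.
  - by rewrite -(leq_add2r q) szQ addSn.
  (* Only the powers of -x and -y could vanish; [x0] and [y0] make the exponent 0 whenever the base
     is 0. *)
  rewrite !mulf_neq0 ?invr_neq0 ?binr_neq0 ?leq_addr // expf_eq0 oppr_eq0.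
    by rewrite negb_and -leqNgt leqn0 orbC -implybE; apply/implyP => /eqP/x0->.
  by rewrite negb_and -leqNgt leqn0 orbC -implybE; apply/implyP => /eqP/y0->.
have P_neq0 : P != 0 by rewrite -size_poly_eq0 szP.
have Q_neq0 : Q != 0 by rewrite -size_poly_eq0 szQ.
have rootP : root P x by apply: contraLR isT => /mupNroot; rewrite multP addnS.
have rootQ : root Q y by apply: contraLR isT => /mupNroot; rewrite multQ addnS.
have n_eq : (p + (q + m.+1) = (p + (q + m)).+1)%N by rewrite !addnS.
rewrite mup_deriv ?schur_szego_neq0 //.
  rewrite n_eq deriv_schur_szego -mul_polyC mupMr; last first.
    by rewrite rootC invr_eq0 pnatr_eq0.
  congr _.+1; apply: IHm; rewrite ?size_deriv_num ?szP ?szQ ?n_eq //.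
    by apply: succn_inj; rewrite -mup_deriv // multP addnS.
  by apply: succn_inj; rewrite -mup_deriv // multQ addnS.
have [A Ax defP] := mup_factor x P_neq0.
have [B By defQ] := mup_factor y Q_neq0.
have A_neq0 : A != 0 by apply: contraNneq Ax => ->; rewrite root0.
have B_neq0 : B != 0 by apply: contraNneq By => ->; rewrite root0.
rewrite multP in defP; rewrite multQ in defQ.
rewrite defP (size_mul_exp_XsubC _ _ A_neq0) in szP.
rewrite defQ (size_mul_exp_XsubC _ _ B_neq0) in szQ.
(* For -xy to be a root, move the surplus (X - x)^(m+1) into the cofactor of (X - x)^p: the
   evaluation formula, with q + m + 1 for q, then has a factor vanishing at x. *)
rewrite /root defP defQ [(p + m.+1)%N]addnC exprD mulrA.
rewrite horner_schur_szego_factors; last first.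
  - by rewrite -(leq_add2r (q + m.+1)) szQ addSn.
  - rewrite size_mul_exp_XsubC //.
    by rewrite -(leq_add2r p) -addnA [(m.+1 + p)%N]addnC szP addSn addnC.
by rewrite hornerM horner_exp hornerXsubC subrr exprS !(mul0r, mulr0).
Qed.

Local Open Scope complex_scope.

(* zeroP and zeroQ are vacuous for nonzero roots. They exclude exactly the
   degenerate instances in which the conclusion fails: if xP = 0 and mQ < n, the
   multiplicity of 0 in the composition is at least mP > mP + mQ - n. *)
Theorem proposition4 (R : realType) (n : nat) (P Q : {poly R[i]})
    (xP xQ : R[i]) (mP mQ : nat)
    (degP : size P = n.+1) (degQ : size Q = n.+1)
    (rootP : root P xP) (rootQ : root Q xQ)
    (multP : mup xP P = mP) (multQ : mup xQ Q = mQ)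
    (zeroP : xP = 0 -> mQ = n) (zeroQ : xQ = 0 -> mP = n)
    (mu_ge0 : (n <= mP + mQ)%N) :
  mup (- (xP * xQ)) (schur_szego n P Q) = (mP + mQ - n)%N /\
  ((mP + mQ)%N = n -> ~~ root (schur_szego n P Q) (- (xP * xQ))).
Proof.
have P_neq0 : P != 0 by rewrite -size_poly_eq0 degP.
have Q_neq0 : Q != 0 by rewrite -size_poly_eq0 degQ.
have le_mPn : (mP <= n)%N by rewrite -multP -ltnS -degP ltn_mup_size.
have le_mQn : (mQ <= n)%N by rewrite -multQ -ltnS -degQ ltn_mup_size.
have mupE : mup (- (xP * xQ)) (schur_szego n P Q) = (mP + mQ - n)%N.
  (* This rewrites n on the right-hand side as well; the next rewriting restores the value of mu^*
     there. *)
  have -> : n = (n - mQ + (n - mP + (mP + mQ - n)))%N by lia.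
  have -> : (mP + mQ - (n - mQ + (n - mP + (mP + mQ - n))) = mP + mQ - n)%N
    by lia.
  apply: mup_schur_szego => [||||/zeroP|/zeroQ];
    by rewrite ?degP ?degQ ?multP ?multQ; lia.
split=> // mPQ; move: mupE; rewrite mPQ subnn => /eqP; rewrite -leqn0.
by rewrite mup_leq ?schur_szego_neq0 // expr1 dvdp_XsubCl.
Qed.
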